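(* Let $F = F(x,y)$ be the free group on $x$ and $y$, and let $(X,Y)$ be an ordered pair of relatively prime integers such that $1 \le X < Y$. Define $(X_0,Y_0) := (X,Y)$ and, inductively for $i = 0,1,2,\dots$, proceed as follows, writing $r_i := Y_i \bmod X_i$: - if $X_i = 1$, terminate the inductive process; - if $X_i \ge 2$ and $r_i \le X_i - r_i$, define $X_{i+1} := r_i$, $Y_{i+1} := X_i - r_i$, $n_i := \max\{n \in \mathbb{N} : nX_i < Y_i\}$, and let $\phi_i$ be the automorphism of $F$ with $x \mapsto xy^{n_i+1}$ and $y \mapsto xy^{n_i}$; - if $X_i \ge 2$ and $r_i > X_i - r_i$, define $X_{i+1} := X_i - r_i$, $Y_{i+1} := r_i$, $n_i := \max\{n \in \mathbb{N} : nX_i < Y_i\}$, and let $\phi_i$ be the automorphism of $F$ with $x \mapsto xy^{n_i}$ and $y \mapsto xy^{n_i+1}$. Then this inductive process terminates after at most $\log_2 X$ iterations. Moreover, if $s$ is the final value of $i$ considered (so $X_s = 1$), then the element $$p := (xy^{Y_s})\,\phi_{s-1}\phi_{s-2}\cdots\phi_0$$ is a primitive element of $F$ with exponent sum pair $(X,Y)$.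
   Context: Functions are written on the right of their arguments, so in $(w)\phi_{s-1}\cdots\phi_0$ the automorphism $\phi_{s-1}$ is applied first and $\phi_0$ last. An element of $F$ is primitive if it is the image of $x$ under some automorphism of $F$. The exponent sum pair of $w \in F$ is the pair $(X,Y)$, where $X$ is the exponent sum of $x$ in $w$ and $Y$ is the exponent sum of $y$ in $w$. For integers $X,Y$ with $X \ne 0$, $Y \bmod X$ is the unique integer $r$ with $0 \le r < |X|$ and $Y = qX + r$ for some $q \in \mathbb{Z}$. Here $\mathbb{N} = \{1,2,3,\dots\}$. An iteration means a step that defines $(X_{i+1},Y_{i+1})$ from $(X_i,Y_i)$, so the number of iterations is $s$. *)

(* Defs.v *)
From HB Require Import structures.
From mathcomp Require Import all_boot all_order all_algebra.
Set Implicit Arguments.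
Unset Strict Implicit.
Unset Printing Implicit Defensive.

(* The free group on [T], as the type of reduced words. The letter [(t, false)]
   stands for the generator [t] and [(t, true)] for its inverse. *)
Section FreeGroup.
Variable T : choiceType.

Definition letter_inv (l : T * bool) : T * bool := (l.1, ~~ l.2).

Definition reduced (w : seq (T * bool)) : bool :=
  sorted (fun l l' => l' != letter_inv l) w.

(* Reduced form of [l :: w] when [w] is reduced. *)
Definition word_push (l : T * bool) (w : seq (T * bool)) : seq (T * bool) :=
  if w is l' :: w' then if l' == letter_inv l then w' else l :: w else [:: l].

Definition word_mul (u v : seq (T * bool)) : seq (T * bool) :=
  foldr word_push v u.

Definition word_inv (w : seq (T * bool)) : seq (T * bool) :=
  rev (map letter_inv w).

Lemma letter_invK : involutive letter_inv.
Proof. by case=> t b; rewrite /letter_inv /= negbK. Qed.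

Lemma reduced_push l w : reduced w -> reduced (word_push l w).
Proof.
case: w => [|l' w'] //= rw; case: eqVneq => [_|nl] /=.
  exact: path_sorted rw.
by rewrite nl.
Qed.

Lemma reduced_mul u v : reduced v -> reduced (word_mul u v).
Proof. by move=> rv; elim: u => //= l u; apply: reduced_push. Qed.

Lemma reduced_inv w : reduced w -> reduced (word_inv w).
Proof.
rewrite /reduced /word_inv rev_sorted sorted_map; apply: sub_sorted => l l' /=.
by rewrite letter_invK; apply: contraNneq => <-.
Qed.

Lemma word_pushK l w :
  reduced w -> word_push l (word_push (letter_inv l) w) = w.
Proof.
case: w => [|l' w] /=; first by rewrite eqxx.
rewrite letter_invK; case: eqVneq => [->|nl] rw /=; last by rewrite eqxx.
by case: w rw => [|l2 w] //= /andP[/negPf->].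
Qed.

Lemma word_mul_push l u w :
  reduced w -> word_mul (word_push l u) w = word_push l (word_mul u w).
Proof.
move=> rw; case: u => [|l' u] //=; case: eqVneq => [->|] //=.
by rewrite word_pushK // reduced_mul.
Qed.

Lemma word_mulA u v w :
  reduced w -> word_mul u (word_mul v w) = word_mul (word_mul u v) w.
Proof. by move=> rw; elim: u => //= l u ->; rewrite word_mul_push. Qed.

Lemma word_muls0 w : reduced w -> word_mul w [::] = w.
Proof.
elim: w => //= l w IHw rw; rewrite IHw; last exact: path_sorted rw.
by case: w rw {IHw} => [|l' w] //= /andP[/negPf->].
Qed.

Lemma word_mulKs w v :
  reduced v -> word_mul (word_inv w) (word_mul w v) = v.
Proof.
move=> rv; elim: w => //= l w IHw.
rewrite /word_inv /= rev_cons /word_mul foldr_rcons.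
by rewrite -{2}[l]letter_invK word_pushK //; apply: reduced_mul.
Qed.

Lemma word_invK : involutive word_inv.
Proof.
by move=> w; rewrite /word_inv map_rev revK mapK //; apply: letter_invK.
Qed.

Record freeGroup := FreeGroup {
  free_word :> seq (T * bool);
  free_wordP : reduced free_word }.

HB.instance Definition _ := [isSub for free_word].
HB.instance Definition _ := [Choice of freeGroup by <:].

Definition free_one : freeGroup := @FreeGroup [::] isT.
Definition free_mul (u v : freeGroup) : freeGroup :=
  FreeGroup (reduced_mul u (free_wordP v)).
Definition free_inv (u : freeGroup) : freeGroup :=
  FreeGroup (reduced_inv (free_wordP u)).

Lemma free_mulA : associative free_mul.
Proof. by move=> u v w; apply/val_inj/word_mulA/free_wordP. Qed.

Lemma free_mul1 : left_id free_one free_mul.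
Proof. by move=> u; apply/val_inj. Qed.

Lemma free_mulr1 : right_id free_one free_mul.
Proof. by move=> u; apply/val_inj/word_muls0/free_wordP. Qed.

Lemma free_mulV : left_inverse free_one free_inv free_mul.
Proof.
move=> u; apply/val_inj => /=.
by rewrite -[X in word_mul _ X](word_muls0 (free_wordP u)) word_mulKs.
Qed.

Lemma free_mulrV : right_inverse free_one free_inv free_mul.
Proof.
move=> u; have uK: free_inv (free_inv u) = u by apply/val_inj/word_invK.
by rewrite -{1}uK free_mulV.
Qed.

HB.instance Definition _ := isGroup.Build freeGroup
  free_mulA free_mul1 free_mulr1 free_mulV free_mulrV.

Definition free_gen (t : T) : freeGroup := @FreeGroup [:: (t, false)] isT.

(* The homomorphism to [G] that sends each generator [t] to [f t]. *)
Definition free_lift (G : groupType) (f : T -> G) (w : freeGroup) : G :=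
  (\prod_(l <- free_word w) (if l.2 then (f l.1)^-1 else f l.1))%g.

Definition exponent_sum (t : T) (w : freeGroup) : int :=
  (\sum_(l <- free_word w | l.1 == t) (if l.2 then -1 else 1))%R.

Definition is_automorphism (f : freeGroup -> freeGroup) : Prop :=
  {morph f : u v / (u * v)%g} /\ bijective f.

End FreeGroup.

Definition expgz (G : groupType) (g : G) (k : int) : G :=
  match k with Posz n => (g ^+ n)%g | Negz n => (g ^- n.+1)%g end.

Notation F2 := (freeGroup bool).

Definition gx : F2 := free_gen true.
Definition gy : F2 := free_gen false.

(* The endomorphism of [F2] with [x |-> a] and [y |-> b]. *)
Definition F2_endo (a b : F2) : F2 -> F2 :=
  free_lift (fun t : bool => if t then a else b).

Definition is_primitive (w : F2) : Prop :=
  exists2 f : F2 -> F2, is_automorphism f & f gx = w.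

Definition exponent_sum_pair (w : F2) : int * int :=
  (exponent_sum true w, exponent_sum false w).

Section Process.
Local Open Scope ring_scope.

Definition process_le (P : int * int) : bool :=
  let r := (P.2 %% P.1)%Z in r <= P.1 - r.

Definition process_step (P : int * int) : int * int :=
  let r := (P.2 %% P.1)%Z in
  if process_le P then (r, P.1 - r) else (P.1 - r, r).

(* The pair [(X_i, Y_i)]. This is meaningful only up to the first [i] with
   [X_i = 1], where the process stops; later values are junk. *)
Definition process_pair (X Y : int) (i : nat) : int * int :=
  iter i process_step (X, Y).

(* The largest [n >= 1] with [n * X < Y]. For [X >= 1] every such [n] is less
   than [Y], so the bound on the index loses nothing; the value is 0 if there
   is no such [n]. *)
Definition process_exp (P : int * int) : nat :=
  \max_(n < `|P.2|.+1 | (0 < n)%N && (n%:Z * P.1 < P.2)) n.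

Definition process_endo (P : int * int) : F2 -> F2 :=
  let n := process_exp P in
  if process_le P then F2_endo (gx * gy ^+ n.+1)%g (gx * gy ^+ n)%g
  else F2_endo (gx * gy ^+ n)%g (gx * gy ^+ n.+1)%g.

(* [(x y^(Y_s)) phi_(s-1) ... phi_0] in right-action notation: the innermost
   application is that of [phi_(s-1)] and the outermost that of [phi_0]. *)
Definition process_element (X Y : int) (s : nat) : F2 :=
  foldr (fun i w => process_endo (process_pair X Y i) w)
    (gx * expgz gy (process_pair X Y s).2)%g (iota 0 s).

End Process.

(* Main.v *)
(** Along the process the pairs stay coprime with [1 <= X_i <= Y_i], and
    [X_(i+1) = min (r_i, X_i - r_i) <= X_i / 2], which bounds the number of
    iterations. Each [phi_i] is invertible because [y = (x y^n)^-1 (x y^(n+1))],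
    so [x] and [y] can be recovered from the images of the generators. On
    abelianizations [phi_i] sends [(X_(i+1), Y_(i+1))] to [(X_i, Y_i)], since
    [X_(i+1) + Y_(i+1) = X_i] and [Y_i = n_i X_i + r_i]. *)
Require Import Defs.
From HB Require Import structures.
From mathcomp Require Import all_boot all_order all_algebra.
From mathcomp Require Import zify.
From mathcomp Require Import reals exp.
Set Implicit Arguments.
Unset Strict Implicit.
Unset Printing Implicit Defensive.
Import Order.TTheory GRing.Theory Num.Theory.
Local Open Scope ring_scope.

Lemma mulVg_mulXS (G : groupType) (a b : G) n :
  ((a * b ^+ n)^-1 * (a * b ^+ n.+1) = b)%g.
Proof. by apply: (canLR (mulKg _)); rewrite expgSr mulgA. Qed.

(** * Homomorphisms out of a free group, and exponent sums *)

Section FreeGroupTheory.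
Variable T : choiceType.
Implicit Types (t : T) (u v w : freeGroup T).

(** A tail of a reduced word is reduced, and no cancellation occurs when its first letter is pushed
    back, so the word is the group product of that letter and the tail. *)
Lemma free_ind (P : freeGroup T -> Prop) :
    P 1%g ->
    (forall t w, P w -> P (free_gen t * w)%g) ->
    (forall t w, P w -> P ((free_gen t)^-1 * w)%g) ->
  forall w, P w.
Proof.
move=> P1 Pgen PgenV [s]; elim: s => [|[t b] s IHs] rs.
  by rewrite (_ : FreeGroup rs = 1%g) //; apply/val_inj.
have rs' : reduced s := path_sorted rs.
have pushE : word_push (t, b) s = (t, b) :: s.
  by case: {IHs} s rs rs' => [|l s] //= /andP[/negPf->].
have := IHs rs'.
case: b pushE {IHs} rs => pushE rs => [/(PgenV t)|/(Pgen t)];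
  congr P; exact/val_inj.
Qed.

Section Lift.
Variables (G : groupType) (f : T -> G).

Let F (l : T * bool) : G := (if l.2 then (f l.1)^-1 else f l.1)%g.

(** A cancelled pair of letters contributes a factor and its inverse, so reduction does not change
    the product. *)
Let prod_push l s :
  (\prod_(k <- word_push l s) F k = F l * \prod_(k <- s) F k)%g.
Proof.
case: s => [|k s] /=; first by rewrite big_seq1 big_nil mulg1.
case: eqVneq => [->|_]; last by rewrite big_cons.
rewrite big_cons mulgA; case: l => t [] /=.
  by rewrite /F /= mulVg mul1g.
by rewrite /F /= mulgV mul1g.
Qed.

Lemma free_liftM : {morph free_lift f : u v / (u * v)%g}.
Proof.
move=> u v; rewrite /free_lift /=.
elim: (free_word u) => [|l s IHs] /=; first by rewrite big_nil mul1g.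
by rewrite prod_push IHs big_cons mulgA.
Qed.

Lemma free_lift1 : free_lift f 1%g = 1%g.
Proof. exact: big_nil. Qed.

HB.instance Definition _ :=
  isUMagmaMorphism.Build (freeGroup T) G (free_lift f) (free_lift1, free_liftM).

Lemma free_lift_gen t : free_lift f (free_gen t) = f t.
Proof. by rewrite /free_lift big_seq1. Qed.

End Lift.

(** The uniqueness half of the universal property of free groups. *)
Lemma free_hom_eq (G : groupType) (f g : UMagmaMorphism.type (freeGroup T) G) :
  (forall t, f (free_gen t) = g (free_gen t)) -> f =1 g.
Proof.
move=> fg; elim/free_ind => [|t w IHw|t w IHw]; first by rewrite !gmulf1.
  by rewrite !gmulfM fg IHw.
by rewrite !gmulfM !gmulfV fg IHw.
Qed.

Lemma exponent_sumM t u v :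
  exponent_sum t (u * v)%g = exponent_sum t u + exponent_sum t v.
Proof.
(* Moving the filter into the summand gives every letter a value; inverse letters have opposite
   values, so cancellation preserves the sum. *)
pose c (l : T * bool) : int :=
  if l.1 == t then if l.2 then -1 else 1 else 0.
have sumE w : exponent_sum t w = \sum_(l <- free_word w) c l.
  by rewrite /exponent_sum big_mkcond.
have sum_push l r :
    \sum_(k <- word_push l r) c k = c l + \sum_(k <- r) c k.
  case: r => [|k r] /=; first by rewrite big_seq1 big_nil addr0.
  case: eqVneq => [->|_]; last by rewrite big_cons.
  by rewrite big_cons /c /=; case: (l.1 == t); case: l.2 => /=; lia.
rewrite !sumE /=; elim: (free_word u) => [|l r IHr] /=.
  by rewrite big_nil add0r.
by rewrite sum_push IHr big_cons addrA.
Qed.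

Lemma exponent_sum1 t : exponent_sum t 1%g = 0.
Proof. by rewrite /exponent_sum big_nil. Qed.

Lemma exponent_sumV t u : exponent_sum t (u^-1)%g = - exponent_sum t u.
Proof.
by apply/eqP; rewrite -addr_eq0 -exponent_sumM mulVg exponent_sum1.
Qed.

Lemma exponent_sumX t u n :
  exponent_sum t (u ^+ n)%g = n%:Z * exponent_sum t u.
Proof.
elim: n => [|n IHn]; first by rewrite expg0 exponent_sum1 mul0r.
by rewrite expgS exponent_sumM IHn; lia.
Qed.

Lemma exponent_sum_gen t t' : exponent_sum t (free_gen t') = (t' == t)%:Z.
Proof. by rewrite /exponent_sum big_mkcond big_seq1 /=; case: eqP. Qed.

End FreeGroupTheory.

(** * Endomorphisms of the free group of rank 2 *)

Section Endomorphisms.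
Implicit Types (a b c d w : F2) (n : nat).

HB.instance Definition _ a b := UMagmaMorphism.on (F2_endo a b).

Lemma F2_endo_gx a b : F2_endo a b gx = a.
Proof. exact: free_lift_gen. Qed.

Lemma F2_endo_gy a b : F2_endo a b gy = b.
Proof. exact: free_lift_gen. Qed.

Lemma F2_endoM a b : {morph F2_endo a b : u v / (u * v)%g}.
Proof. exact: gmulfM. Qed.

Lemma F2_endoV a b : {morph F2_endo a b : u / (u^-1)%g}.
Proof. exact: gmulfV. Qed.

Lemma F2_endoX a b n : {morph F2_endo a b : u / (u ^+ n)%g}.
Proof. exact: gmulfXn. Qed.

Definition F2_endoE := (F2_endo_gx, F2_endo_gy, F2_endoM, F2_endoV, F2_endoX).

Lemma F2_endoK a b c d :
    F2_endo c d a = gx -> F2_endo c d b = gy ->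
  cancel (F2_endo a b) (F2_endo c d).
Proof.
move=> ax by_ w; apply: (free_hom_eq (f := F2_endo c d \o F2_endo a b)
  (g := idfun)) => -[] /=.
  by rewrite -/gx F2_endo_gx.
by rewrite -/gy F2_endo_gy.
Qed.

Lemma F2_endo_automorphism a b c d :
    F2_endo c d a = gx -> F2_endo c d b = gy ->
    F2_endo a b c = gx -> F2_endo a b d = gy ->
  is_automorphism (F2_endo a b).
Proof.
move=> *; split; first exact: F2_endoM.
by exists (F2_endo c d); apply: F2_endoK.
Qed.

(** This handles the end of the process, where [x y^n] is the image of [x]. *)
Lemma transvection_automorphism n :
  is_automorphism (F2_endo (gx * gy ^+ n)%g gy).
Proof.
apply: (@F2_endo_automorphism _ _ (gx * gy ^- n)%g gy);
  by rewrite !F2_endoE ?mulgK ?mulgVK.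
Qed.

Lemma process_le_automorphism n :
  is_automorphism (F2_endo (gx * gy ^+ n.+1)%g (gx * gy ^+ n)%g).
Proof.
(* With [a = x y^(n+1)] and [b = x y^n] one has [y = b^-1 a] and [x = b y^-n]; the inverse is read
   off by renaming [a], [b] to [x], [y]. *)
apply: (@F2_endo_automorphism _ _ (gy * (gy^-1 * gx) ^- n)%g (gy^-1 * gx)%g);
  rewrite !F2_endoE ?mulVg_mulXS ?mulgK ?mulgVK //.
by rewrite expgSr mulgA mulgVK mulVKg.
Qed.

Lemma process_gt_automorphism n :
  is_automorphism (F2_endo (gx * gy ^+ n)%g (gx * gy ^+ n.+1)%g).
Proof.
(* Now [a = x y^n] and [b = x y^(n+1)], so [y = a^-1 b] and [x = a y^-n]. *)
apply: (@F2_endo_automorphism _ _ (gx * (gx^-1 * gy) ^- n)%g (gx^-1 * gy)%g);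
  rewrite !F2_endoE ?mulVg_mulXS ?mulgK ?mulgVK //.
by rewrite expgSr mulgA mulgVK mulVKg.
Qed.

(** This is the matrix of the induced map on the abelianization. *)
Lemma exponent_sum_endo t a b w :
  exponent_sum t (F2_endo a b w) =
    exponent_sum true w * exponent_sum t a
    + exponent_sum false w * exponent_sum t b.
Proof.
elim/free_ind: w => [|t' w IHw|t' w IHw].
- by rewrite gmulf1 !exponent_sum1 !mul0r.
- rewrite F2_endoM !exponent_sumM IHw !exponent_sum_gen.
  by case: t'; rewrite -/gx -/gy ?F2_endo_gx ?F2_endo_gy /=; lia.
- rewrite F2_endoM F2_endoV !exponent_sumM IHw !exponent_sumV !exponent_sum_gen.
  by case: t'; rewrite -/gx -/gy ?F2_endo_gx ?F2_endo_gy /=; lia.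
Qed.

Lemma exponent_sum_gx t : exponent_sum t gx = t%:Z.
Proof. by rewrite exponent_sum_gen; case: t. Qed.

Lemma exponent_sum_gy t : exponent_sum t gy = (~~ t)%:Z.
Proof. by rewrite exponent_sum_gen; case: t. Qed.

Lemma automorphism_primitive (f : F2 -> F2) w :
  is_automorphism f -> is_primitive w -> is_primitive (f w).
Proof.
move=> [fM f_bij] [g [gM g_bij] <-]; exists (f \o g) => //; split.
  by move=> u v /=; rewrite gM fM.
exact: bij_comp.
Qed.

End Endomorphisms.

(** * The inductive process *)

Section Process.
Implicit Types (X Y : int) (P : int * int) (s i : nat).

Local Arguments process_pair : simpl never.

Lemma process_endo_automorphism P : is_automorphism (process_endo P).
Proof.
rewrite /process_endo; case: process_le.
  exact: process_le_automorphism.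
exact: process_gt_automorphism.
Qed.

(** Peeling off the first step rather than the last lets an induction restart the process at the
    second pair. *)
Lemma process_pairS X Y i :
  process_pair X Y i.+1 =
  process_pair (process_step (X, Y)).1 (process_step (X, Y)).2 i.
Proof. by rewrite /process_pair iterSr -surjective_pairing. Qed.

Lemma process_elementS X Y s :
  process_element X Y s.+1 =
  process_endo (X, Y)
    (process_element (process_step (X, Y)).1 (process_step (X, Y)).2 s).
Proof.
rewrite /process_element /= process_pairS; congr process_endo.
rewrite -[1%N]addn0 iotaDl foldr_map.
by elim: (iota 0 s) => //= i r ->; rewrite process_pairS.
Qed.

(** A zero remainder would make [X >= 2] a common divisor. *)
Lemma coprime_modz_gt0 X Y : 2 <= X -> coprimez X Y -> 0 < (Y %% X)%Z.
Proof.
move=> X2 cop; rewrite lt0r modz_ge0 ?andbT; last by lia.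
by apply/eqP => r0; move: cop; rewrite /coprimez -gcdz_modr r0 gcdz0; lia.
Qed.

(** Since the remainder is positive, [n X < Y] and [n X <= Y] have the same largest solution;
    [X < Y] makes it at least 1. *)
Lemma process_expE X Y :
  2 <= X -> X < Y -> coprimez X Y -> (process_exp (X, Y))%:Z = (Y %/ X)%Z.
Proof.
move=> X2 ltXY cop; have r_gt0 := coprime_modz_gt0 X2 cop.
have r_lt : (Y %% X)%Z < X by apply: ltz_pmod; lia.
have YE := divz_eq Y X; set q := (Y %/ X)%Z in YE *; set r := (Y %% X)%Z in YE *.
have q_gt0 : 0 < q by nia.
suff -> : process_exp (X, Y) = `|q|%N by lia.
apply/eqP; rewrite /process_exp eqn_leq /=; apply/andP; split.
  by apply/bigmax_leqP => n /andP[n_gt0 ltnXY]; nia.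
have ltq : (`|q| < `|Y|.+1)%N by nia.
by apply: (bigop.bigmax_sup (Ordinal ltq)) => //=; nia.
Qed.

Lemma process_stepP X Y : 2 <= X -> coprimez X Y ->
  let P := process_step (X, Y) in
  [/\ coprimez P.1 P.2, 1 <= P.1, P.1 <= P.2 & 2 * P.1 <= X].
Proof.
move=> X2 cop; have r_gt0 := coprime_modz_gt0 X2 cop.
have r_lt : (Y %% X)%Z < X by apply: ltz_pmod; lia.
(* [gcd(r, X - r) = gcd(r, X) = gcd(X, Y)]. *)
have copr : coprimez (Y %% X)%Z (X - (Y %% X)%Z).
  rewrite /coprimez -gcdzDr addrNK gcdzC gcdz_modr; exact: cop.
rewrite /process_step /process_le /=; case: ifP => /= le_r.
  by split=> //; lia.
by split; first rewrite coprimez_sym //; lia.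
Qed.

(** In both branches the generator with exponent sum [r] is the one sent to [x y^(n+1)], so the
    exponent sum of [y] becomes [r (n+1) + (X - r) n = n X + r = Y]. *)
Lemma process_exponent_sum X Y w : 2 <= X -> X < Y -> coprimez X Y ->
    exponent_sum_pair w = process_step (X, Y) ->
  exponent_sum_pair (process_endo (X, Y) w) = (X, Y).
Proof.
move=> X2 ltXY cop; have := process_expE X2 ltXY cop.
have := divz_eq Y X; rewrite /exponent_sum_pair /process_step /process_endo.
set n := process_exp _ => YE nE.
case: process_le => /= -[wx wy]; rewrite !exponent_sum_endo !exponent_sumM
  !exponent_sumX !exponent_sum_gx !exponent_sum_gy wx wy /=;
  by congr pair; nia.
Qed.

(** The inequality [X <= Y] is weak because a step from [X = 2] produces [(1, 1)]. The bound
    [2 ^+ s <= X] is the integral form of the logarithmic one. *)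
Lemma process_correct X Y : coprimez X Y -> 1 <= X -> X <= Y ->
  exists s : nat,
    [/\ (forall i, (i < s)%N -> 2 <= (process_pair X Y i).1),
        (process_pair X Y s).1 = 1 & 2 ^+ s <= X]
    /\ is_primitive (process_element X Y s)
    /\ exponent_sum_pair (process_element X Y s) = (X, Y).
Proof.
(* Strong induction on [X], which each step at least halves. *)
have [m] := ubnP `|X|%N; elim: m => // m IHm in X Y * => ltXm cop X1 leXY.
have [X_eq1|X_neq1] := eqVneq X 1.
  (* [Y] is nonnegative, so [expgz] reduces to a natural power. *)
  case: Y leXY {cop} => [k|k] leXY; last by lia.
  exists 0%N; split; first by split; rewrite ?expr0 ?X_eq1.
  rewrite X_eq1 /process_element /=; split.
    exists (F2_endo (gx * gy ^+ k)%g gy); last exact: F2_endo_gx.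
    exact: transvection_automorphism.
  rewrite /exponent_sum_pair !exponent_sumM !exponent_sumX.
  by rewrite !exponent_sum_gx !exponent_sum_gy /=; congr pair; lia.
have X2 : 2 <= X by lia.
(* Coprimality excludes [X = Y] once [X >= 2]. *)
have ltXY : X < Y.
  rewrite lt_neqAle leXY andbT; apply: contraTneq cop => <-.
  by rewrite /coprimez gcdzz; lia.
have [copS S1 leS halfS] := process_stepP X2 cop.
have ltSm : (`|(process_step (X, Y)).1| < m)%N by lia.
have [s [[ge2 eq1 le_pow] [prim sumE]]] := IHm _ _ ltSm copS S1 leS.
exists s.+1; rewrite process_elementS process_pairS; split; split=> //.
- by case=> [|i] // lti; rewrite process_pairS; apply: ge2.
- by rewrite exprS; lia.
- exact/automorphism_primitive/prim/process_endo_automorphism.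
- by apply: process_exponent_sum => //; rewrite sumE -surjective_pairing.
Qed.

End Process.

Theorem mainTheorem2 (R : realType) (X Y : int)
    (copXY : coprimez X Y) (X_ge1 : 1 <= X) (ltXY : X < Y) :
  exists s : nat,
    [/\ (forall i : nat, (i < s)%N -> 2 <= (process_pair X Y i).1),
        (process_pair X Y s).1 = 1
      & s%:R <= ln (X%:~R : R) / ln 2]
    /\ [/\ (forall i : nat, (i < s)%N ->
             is_automorphism (process_endo (process_pair X Y i))),
           is_primitive (process_element X Y s)
         & exponent_sum_pair (process_element X Y s) = (X, Y)].
Proof.
have [s [[ge2 eq1 le_pow] [prim sumE]]] := process_correct copXY X_ge1 (ltW ltXY).
exists s; split; split=> //; last by move=> i _; apply: process_endo_automorphism.
have ln2_gt0 : 0 < ln (2 : R) by rewrite ln_gt0 // ltr1n.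
(* Clearing the denominator turns the bound into [ln (2^s) <= ln X], that is [2^s <= X]. *)
rewrite ler_pdivlMr // mulr_natl -lnXn ?ltr0n // ler_ln ?posrE ?exprn_gt0 //.
  by rewrite -[2 in leLHS]/(2%:~R) -rmorphXn /= ler_int.
by rewrite ltr0z; lia.
Qed.
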